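(* If $\lambda=-u^2$ is a real number such that $|\lambda|\ge4\cos^2(\pi/(n+1))$ for some integer $n>1$, then the minimal $u$-degree of $\lambda$ is greater than or equal to $n$, and equality holds only if $\lambda=\pm4\cos^2(\pi/(n+1))$. In particular, for every integer $l\ge1$, $4\cos^2(\pi/(2l+2))$ is the largest $l$-step relation number among real numbers.
   Context: For an integer sequence $\mathbf n=(n_1,n_2,\dots)$: $s^{\mathbf n}_0(t)=0$, $s^{\mathbf n}_1(t)=1$, $s^{\mathbf n}_{j+1}(t)=n_j\,t\,s^{\mathbf n}_j(t)-s^{\mathbf n}_{j-1}(t)$. For $\lambda=-u^2\in\mathbb C$, the minimal $u$-degree of $\lambda$ is the minimal length $k\ge1$ of a sequence $\mathbf n=(n_1,\dots,n_k)$ of nonzero integers with $s^{\mathbf n}_{k+1}(u)=0$ ($\infty$ if none exists). A nonzero $\lambda=-u^2\in\mathbb C$ is an $l$-step relation number if $s^{\mathbf n}_{2m+2}(u)=0$ for some integer $m\in[0,l]$ and some sequence $\mathbf n=(n_1,\dots,n_{2m+1})$ of nonzero integers. *)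

(* Defs.v *)
From mathcomp Require Import all_boot all_order all_algebra.
From mathcomp Require Import complex.
From mathcomp Require Import classical_sets reals constructive_ereal ereal trigo.

Set Implicit Arguments.
Unset Strict Implicit.
Unset Printing Implicit Defensive.

Import Order.TTheory GRing.Theory Num.Theory.

Local Open Scope classical_set_scope.
Local Open Scope ring_scope.
Local Open Scope complex_scope.

(* s^n_j(t), evaluated at an element t of an arbitrary commutative ring.      *)
(* The sequence n is indexed from 1, as in the recurrence                     *)
(* s_(j+1) = n_j t s_j - s_(j-1); the value n 0 is never used.                *)
Fixpoint spoly (A : comNzRingType) (n : nat -> int) (j : nat) (t : A) : A :=
  match j with
  | 0 => 0
  | i.+1 => match i with
            | 0 => 1
            | k.+1 => (n i)%:~R * t * spoly n i t - spoly n k t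
            end
  end.

(* A finite sequence (n_1, ..., n_k) seen as a 1-indexed function. The        *)
(* default value 0 is irrelevant: s_(k+1) only involves n_1, ..., n_k.        *)
Definition seq1 (ns : seq int) : nat -> int := fun j => nth 0 ns j.-1.

Definition annihilating_length (R : realType) (u : R[i]) (k : nat) : Prop :=
  exists ns : seq int,
    [/\ size ns = k, 0 \notin ns & spoly (seq1 ns) k.+1 u = 0].

(* The minimal u-degree of lambda = - u ^+ 2. It depends on lambda only,      *)
(* since replacing u by - u changes each s_j(u) at most by a sign. An infimum *)
(* of natural numbers is a minimum, and the infimum of the empty set is +oo.  *)
Definition min_udegree (R : realType) (u : R[i]) : \bar R :=
  ereal_inf [set (k%:R)%:E | k in
    [set k : nat | (1 <= k)%N /\ annihilating_length u k]].

Definition relation_number (R : realType) (l : nat) (lam : R[i]) : Prop :=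
  lam != 0 /\
  exists2 u : R[i], lam = - u ^+ 2 &
    exists2 m : nat, (m <= l)%N & annihilating_length u (2 * m + 1).

(* Main.v *)
(** The Chebyshev-like sequence S_j = sin (j theta) satisfies
    S_(j+2) = 2 cos theta S_(j+1) - S_j and is positive for 0 < j <= n when
    theta = pi / (n+1). If |u| >= 2 cos theta, the terms of s_j(u) grow in
    modulus at least as fast as S_j, because every |n_j| >= 1; hence s_(k+1)(u)
    cannot vanish for k < n, nor for k = n when |u| > 2 cos theta. The bound is
    attained at u = 2 i cos theta with alternating signs n_j = (-1)^(j+1), where
    s_j(u) is S_j / sin theta up to a power of i. *)
Require Import Defs.
From mathcomp Require Import all_boot all_order all_algebra.
From mathcomp Require Import complex.
From mathcomp Require Import classical_sets reals constructive_ereal ereal trigo.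
From mathcomp Require Import ring.

Set Implicit Arguments.
Unset Strict Implicit.
Unset Printing Implicit Defensive.

Import Order.TTheory GRing.Theory Num.Theory.

Local Open Scope ring_scope.
Local Open Scope complex_scope.

Lemma spolySS (A : comNzRingType) (ns : nat -> int) (j : nat) (t : A) :
  spoly ns j.+2 t = (ns j.+1)%:~R * t * spoly ns j.+1 t - spoly ns j t.
Proof. by []. Qed.

Lemma norm_intr_ge1 (A : numDomainType) (z : int) : z != 0 -> 1 <= `|z%:~R : A|.
Proof. by move=> z0; rewrite -intr_norm ler1z -gtz0_ge1 normr_gt0. Qed.

Section Comparison.
Variables (A : numDomainType) (ns : nat -> int) (t c : A) (S : nat -> A) (N : nat).
Hypotheses (S0 : S 0%N = 0) (SSS : forall j, S j.+2 = c * S j.+1 - S j).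
Hypothesis S_gt0 : forall j, (0 < j <= N)%N -> 0 < S j.
Hypothesis ns_neq0 : forall j, (0 < j <= N)%N -> ns j != 0.
Hypothesis le_ct : c <= `|t|.

(* The term with [`|t| - c] is the slack that yields the strict case in
   [spoly_last_neq0], where [S N.+1] may vanish. *)
Lemma spoly_growth j : (j < N)%N ->
  (`|t| - c) * (S j.+1 * `|spoly ns j.+1 t|) + S j.+2 * `|spoly ns j.+1 t|
    <= S j.+1 * `|spoly ns j.+2 t|.
Proof.
elim: j => [|j IHj] jN.
  have S1 : 0 <= S 1%N by rewrite ltW// S_gt0.
  rewrite spolySS SSS S0 /= !subr0 !mulr1 normr1 !mulr1 -mulrDl subrK mulrC.
  by rewrite normrM ler_wpM2l// ler_peMl// norm_intr_ge1 ?ns_neq0.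
have /ltW Sj2 : 0 < S j.+2 by rewrite S_gt0.
have /ltW Sj1 : 0 < S j.+1 by apply: S_gt0; exact: ltnW jN.
set x := `|spoly ns j.+1 t| in IHj; set y := `|spoly ns j.+2 t| in IHj *.
have xy : S j.+2 * x <= S j.+1 * y.
  apply: le_trans (IHj (ltnW jN)).
  by rewrite lerDr mulr_ge0 ?subr_ge0// mulr_ge0// normr_ge0.
(* By the recurrence for [S], this bound exceeds the left side by exactly [S j.+1 * y - S j.+2 * x],
   nonnegative by [xy]; the reverse triangle inequality then compares it with the right side. *)
apply: (@le_trans _ _ (S j.+2 * (`|t| * y - x))).
  rewrite [S j.+3]SSS -subr_ge0 (_ : _ - _ = S j.+1 * y - S j.+2 * x) ?subr_ge0//.
  by ring.
apply: ler_wpM2l => //; rewrite [spoly ns j.+3 t]spolySS.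
apply: le_trans (lerB_dist _ _); rewrite lerD2r !normrM ler_wpM2r ?normr_ge0//.
by rewrite ler_peMl// norm_intr_ge1 ?ns_neq0.
Qed.

(** Once a term is nonzero, the left side of the growth inequality is positive, which forces the
    next term to be nonzero. *)
Lemma spoly_neq0 j : (j < N)%N -> spoly ns j.+1 t != 0.
Proof.
elim: j => [|j IHj] jN; first by rewrite oner_neq0.
have Sj1 : 0 < S j.+1 by apply: S_gt0; exact: ltnW jN.
rewrite -normr_gt0 -(pmulr_rgt0 _ Sj1); apply: lt_le_trans (spoly_growth (ltnW jN)).
have y0 : 0 < `|spoly ns j.+1 t| by rewrite normr_gt0 IHj// ltnW.
apply: ltr_wpDl; first by rewrite mulr_ge0 ?subr_ge0// mulr_ge0// ltW.
by rewrite mulr_gt0// S_gt0.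
Qed.

Lemma spoly_last_neq0 : (0 < N)%N -> 0 < (`|t| - c) * S N + S N.+1 ->
  spoly ns N.+1 t != 0.
Proof.
case: N S_gt0 spoly_neq0 spoly_growth => // M SM_gt0 sM_neq0 growth _ gap.
have SM : 0 < S M.+1 by rewrite SM_gt0 ?leqnn.
rewrite -normr_gt0 -(pmulr_rgt0 _ SM); apply: lt_le_trans (growth _ (ltnSn M)).
by rewrite mulrA -mulrDl mulr_gt0// normr_gt0 sM_neq0.
Qed.

End Comparison.

Lemma sin_mul_rec (R : realType) (x : R) j :
  sin (j.+2%:R * x) = 2 * cos x * sin (j.+1%:R * x) - sin (j%:R * x).
Proof.
have -> : j.+2%:R * x = j.+1%:R * x + x by rewrite -natr1 mulrDl mul1r.
have -> : j%:R * x = j.+1%:R * x - x by rewrite -natr1 mulrDl mul1r addrK.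
rewrite sinD sinB; ring.
Qed.

Lemma sin_mul_pi_gt0 (R : realType) (n j : nat) :
  (0 < j <= n)%N -> 0 < sin (j%:R * (pi / n.+1%:R) : R).
Proof.
case/andP=> j0 jn; apply: sin_gt0_pi.
rewrite mulr_gt0 ?divr_gt0 ?pi_gt0 ?ltr0n//=.
by rewrite mulrCA gtr_pMr ?pi_gt0// ltr_pdivrMr// mul1r ltr_nat ltnS.
Qed.

Lemma cos_pi_div_gt0 (R : realType) (n : nat) :
  (1 < n)%N -> 0 < cos (pi / n.+1%:R : R).
Proof.
move=> n1; have p0 := pi_gt0 R.
have q0 : 0 < pi / n.+1%:R :> R by rewrite divr_gt0 ?ltr0n.
apply: cos_gt0_pihalf; rewrite (lt_trans _ q0) ?oppr_lt0 ?divr_gt0//=.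
by rewrite ltr_pM2l// ltf_pV2 ?posrE ?ltr0n// ltr_nat.
Qed.

(** As [|u| ^+ 2 = |x|], squaring carries bounds on the complex modulus over to the real number, in
    both the weak and the strict form. *)
Lemma norm_sqr_real (R : rcfType) (u : R[i]) (x c : R) : 0 <= c ->
  x%:C = - u ^+ 2 ->
  ((c%:C <= `|u|) = (c ^+ 2 <= `|x|)) * ((c%:C < `|u|) = (c ^+ 2 < `|x|)).
Proof.
move=> c0 xu.
have nx : `|u| ^+ 2 = `|x|%:C.
  by rewrite -normrX -[u ^+ 2]opprK -xu normrN normc_def /= expr0n addr0 sqrtr_sqr.
have cC : 0 <= c%:C by rewrite lecR.
split.
  by rewrite -(@ler_pXn2r _ 2) ?nnegrE// nx -rmorphXn /= lecR.
by rewrite -(@ltr_pXn2r _ 2) ?nnegrE// nx -rmorphXn /= ltcR.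
Qed.

Lemma annihilating_length_ge (R : realType) (u : R[i]) (n k : nat) :
    (1 < n)%N -> (2 * cos (pi / n.+1%:R : R))%:C <= `|u| ->
    (1 <= k)%N -> annihilating_length u k ->
  (n <= k)%N /\ ((2 * cos (pi / n.+1%:R : R))%:C < `|u| -> (n < k)%N).
Proof.
set th := pi / _ => n1 cu k1 [ns [szns ns0 uroot]].
(* The comparison is homogeneous in [S], so no division by [sin th] is needed. It is applied with
   last index [k]. *)
pose S j := (sin (j%:R * th))%:C.
have S0 : S 0%N = 0 by rewrite /S mul0r sin0.
have SSS j : S j.+2 = (2 * cos th)%:C * S j.+1 - S j.
  by rewrite /S sin_mul_rec rmorphB rmorphM.
have S_gt0 j : (0 < j <= n)%N -> 0 < S j by move=> ?; rewrite ltcR sin_mul_pi_gt0.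
have S_last : S n.+1 = 0 by rewrite /S mulrCA mulfV ?pnatr_eq0// mulr1 sinpi.
have ns_neq0 j : (0 < j <= k)%N -> seq1 ns j != 0.
  by case: j => // j jk; apply: contraNneq ns0 => <-; rewrite mem_nth// szns.
have absurd : (k <= n)%N ->
    ~ 0 < (`|u| - (2 * cos th)%:C) * S k + S k.+1.
  move=> kn gap; suff : spoly (seq1 ns) k.+1 u != 0 by rewrite uroot eqxx.
  apply: spoly_last_neq0 S0 SSS _ ns_neq0 cu k1 gap => j /andP[j0 jk].
  by rewrite S_gt0// j0 (leq_trans jk).
split=> [|cu1]; rewrite leqNgt; apply/negP => kn; apply: absurd.
- exact: ltnW.
- by rewrite ltr_wpDl ?S_gt0// mulr_ge0 ?subr_ge0// ltW ?S_gt0// k1 ltnW.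
- by [].
(* Here [k = n] is allowed: [S n.+1] is then [sin pi = 0], and positivity comes from the strict
   bound on [|u|] alone. *)
- rewrite ltr_wpDr//; last by rewrite mulr_gt0 ?subr_gt0// S_gt0// k1.
  by move: kn; rewrite ltnS leq_eqVlt => /predU1P[->|kn];
    rewrite ?S_last// ltW ?S_gt0.
Qed.

Lemma min_udegree_ge (R : realType) (u : R[i]) (n : nat) :
  (forall k, (1 <= k)%N -> annihilating_length u k -> (n <= k)%N) ->
  ((n%:R)%:E <= min_udegree u)%E.
Proof.
move=> H; apply: le_ereal_inf_tmp => _ [k [k1 uk] <-].
by rewrite lee_fin ler_nat H.
Qed.

(** The alternating signs absorb [i ^+ 2 = -1], so the recurrence becomes that of [sin (j x)] and
    the powers of i reduce to 1 and i by parity. Multiplying by [sin x] avoids dividing by a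
    possible zero. *)
Lemma spoly_alternating (R : realType) (x : R) (ns : nat -> int) (m : nat) :
    (forall j, (0 < j <= m)%N -> ns j = (-1) ^+ j.-1) ->
  forall j, (j <= m.+1)%N ->
  spoly ns j ('i%C * (2 * cos x)%:C) * (sin x)%:C =
    (if odd j then 1 else 'i%C) * (sin (j%:R * x))%:C.
Proof.
move=> nsE j; elim/ltn_ind: j => -[|[|j]] IHj jm.
- by rewrite !mul0r sin0 mulr0.
- by rewrite !mul1r.
have := IHj j.+1 (ltnSn _) (ltnW jm).
have := IHj j (ltnW (ltnSn _)) (ltnW (ltnW jm)).
rewrite spolySS nsE// sin_mul_rec rmorphB !rmorphM.
move: (spoly ns j _) (spoly ns j.+1 _) => a b Ha Hb.
rewrite mulrBl -[_ * b * _]mulrA Ha Hb /= negbK.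
have ii : 'i%C * 'i%C = -1 :> R[i] by rewrite -expr2 sqr_i.
rewrite -signr_odd; case: (odd j) => /=; rewrite ?expr0 ?expr1 ?rmorphN ?rmorph1.
- by ring: ii.
- by ring: ii.
Qed.

(** Contrapositive of the strict half of [annihilating_length_ge]; it gives the upper bound on
    relation numbers. *)
Lemma norm_le_of_annihilating (R : realType) (u : R[i]) (x : R) (n k : nat) :
    (1 < n)%N -> x%:C = - u ^+ 2 -> (1 <= k <= n)%N -> annihilating_length u k ->
  `|x| <= 4 * cos (pi / n.+1%:R) ^+ 2.
Proof.
move=> n1 xu /andP[k1 kn] uk; set c := cos _.
have c0 : 0 <= 2 * c by rewrite mulr_ge0// ltW// cos_pi_div_gt0.
have c2 : 4 * c ^+ 2 = (2 * c) ^+ 2 by ring.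
rewrite leNgt c2; apply/negP; rewrite -(norm_sqr_real c0 xu).2 => cu.
have [_ /(_ cu)] := annihilating_length_ge n1 (ltW cu) k1 uk.
by rewrite ltnNge kn.
Qed.

Lemma relation_number_cos (R : realType) (l : nat) : (1 <= l)%N ->
  relation_number l (4 * cos (pi / (2 * l + 2)%:R) ^+ 2 : R)%:C.
Proof.
move=> l1; have -> : (2 * l + 2 = (2 * l).+2)%N by rewrite addn2.
set x := pi / _; have n1 : (1 < (2 * l).+1)%N by rewrite ltnS muln_gt0.
have c0 : 0 < cos x by exact: cos_pi_div_gt0 n1.
split; first by rewrite fmorph_eq0 lt0r_neq0// mulr_gt0// exprn_gt0.
exists ('i%C * (2 * cos x)%:C).
  by rewrite exprMn sqr_i mulN1r opprK -rmorphXn exprMn -natrX.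
exists l => //.
(* The list is indexed from 0, so its entry [j] is the coefficient with index [j.+1]. *)
exists (mkseq (fun j => (-1) ^+ j) (2 * l).+1).
rewrite size_mkseq addn1; split=> //.
  by apply/mapP => -[j _] /esym/eqP; rewrite signr_eq0.
have s0 : (sin x)%:C != 0 :> R[i].
  have := @sin_mul_pi_gt0 R (2 * l).+1 1 isT.
  by rewrite mul1r => /lt0r_neq0; rewrite fmorph_eq0.
(* At index [2 l + 2] the angle is pi, whose sine vanishes, while [sin x] is nonzero and can be
   cancelled. *)
apply: (mulIf s0); rewrite mul0r (@spoly_alternating _ _ _ (2 * l).+1)//.
  by rewrite /x mulrCA mulfV ?pnatr_eq0// mulr1 sinpi mulr0.
by case=> // j jm; rewrite /seq1 nth_mkseq.
Qed.

Theorem proposition6p6 (R : realType) :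
  (forall (n : nat) (u : R[i]) (lam : R),
     (1 < n)%N ->
     lam%:C = - u ^+ 2 ->
     4 * cos (pi / n.+1%:R) ^+ 2 <= `|lam| ->
     ((n%:R)%:E <= min_udegree u)%E /\
     (min_udegree u = (n%:R)%:E ->
        lam = 4 * cos (pi / n.+1%:R) ^+ 2 \/
        lam = - (4 * cos (pi / n.+1%:R) ^+ 2))) /\
  (forall l : nat, (1 <= l)%N ->
     relation_number l (4 * cos (pi / (2 * l + 2)%:R) ^+ 2 : R)%:C /\
     (forall x : R, relation_number l x%:C ->
        x <= 4 * cos (pi / (2 * l + 2)%:R) ^+ 2)).
Proof.
split=> [n u lam n1 lamu|l l1]; last first.
  split=> [|x [_ [u xu [m ml uk]]]]; first exact: relation_number_cos.
  have -> : (2 * l + 2 = (2 * l + 1).+1)%N by rewrite addn2 addn1.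
  have n1 : (1 < 2 * l + 1)%N by rewrite addn1 ltnS muln_gt0.
  apply: le_trans (ler_norm x) (norm_le_of_annihilating n1 xu _ uk).
  by rewrite addn1 ltn0Sn/= addn1 ltnS leq_mul2l.
set c := cos _ => clam.
have c0 : 0 <= 2 * c by rewrite mulr_ge0// ltW// cos_pi_div_gt0.
have c2 : 4 * c ^+ 2 = (2 * c) ^+ 2 by ring.
have cu : (2 * c)%:C <= `|u| by rewrite (norm_sqr_real c0 lamu).1 -c2.
split=> [|degu].
  apply: min_udegree_ge => k k1 uk.
  exact: (annihilating_length_ge n1 cu k1 uk).1.
have lamE : `|lam| = 4 * c ^+ 2.
  apply/eqP; rewrite eq_le clam andbT leNgt c2 -(norm_sqr_real c0 lamu).2.
  (* A strict bound on [|u|] would push every annihilating length, hence the infimum, up to at least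
     [n + 1]. *)
  apply/negP => cu1; suff : ((n.+1%:R)%:E <= min_udegree u)%E.
    by rewrite degu lee_fin ler_nat ltnn.
  apply: min_udegree_ge => k k1 uk.
  exact: (annihilating_length_ge n1 cu k1 uk).2.
by rewrite -lamE; case: ger0P; [left|right; rewrite opprK].
Qed.
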